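(* Let $\lambda\geq\aleph_0$ be a cardinal. Then, considering groups up to isomorphism of abstract groups, $\mathrm{Aut}(\mathbf{K}^{\lambda}_{\mathrm{gf}})\neq\mathrm{Aut}(\mathbf{K}^{\lambda}_{\mathrm{lf}})$; that is, the class of groups isomorphic to the automorphism group of some graph with domain $\lambda$ is different from the class of groups isomorphic to the automorphism group of some locally finite group with domain $\lambda$.
   Context: $\mathbf{K}_{\mathrm{lf}}$ denotes the class of locally finite groups (groups in which every finitely generated subgroup is finite), and $\mathbf{K}_{\mathrm{gf}}$ denotes the class of graphs. For a class $\mathbf{K}$ of structures and an infinite cardinal $\lambda$, $\mathbf{K}^{\lambda}=\{M\in\mathbf{K} : \text{the domain of } M \text{ is } \lambda\}$ and $\mathrm{Aut}(\mathbf{K})=\{\mathrm{Aut}(M) : M\in\mathbf{K}\}$. *)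

(* Defs.v *)
From HB Require Import structures.
From mathcomp Require Import all_boot.
From mathcomp Require Import boolp classical_sets functions cardinality.

Set Implicit Arguments.
Unset Strict Implicit.
Unset Printing Implicit Defensive.

Local Open Scope classical_set_scope.
Local Open Scope group_scope.

Definition isomorphic (G H : groupType) : Prop :=
  exists f : {multiplicative G -> H}, bijective f.

Definition generated (G : groupType) (S : set G) : set G :=
  smallest (fun A : set G => group_closed (mem A)) S.

Definition locally_finite (G : groupType) : Prop :=
  forall S : set G, finite_set S -> finite_set (generated S).

Definition simple_graph (L : Type) (e : rel L) : Prop :=
  symmetric e /\ irreflexive e.

Record sym (T : Type) : Type := Sym { sym_fun :> T -> T; _ : `[< bijective sym_fun >] }.

HB.instance Definition _ (T : Type) := [isSub for @sym_fun T].
HB.instance Definition _ (T : Type) := gen_eqMixin (sym T).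
HB.instance Definition _ (T : Type) := gen_choiceMixin (sym T).

Section SymGroup.
Variable T : Type.
Implicit Types f g h : sym T.

Lemma symP f : bijective f. Proof. by apply/asboolP; case: f. Qed.

Lemma sym_ext f g : f =1 g -> f = g.
Proof. by move=> fg; apply/val_inj/funext. Qed.

Definition sym_one : sym T := Sym (asboolT (Bijective (frefl id) (frefl id))).

Definition sym_mul f g : sym T := Sym (asboolT (bij_comp (symP f) (symP g))).

Lemma sym_inv_subproof f : exists g : sym T, cancel f g /\ cancel g f.
Proof.
have [g fK gK] := symP f.
by exists (Sym (asboolT (Bijective gK fK))).
Qed.

Definition sym_inv f : sym T := sval (cid (sym_inv_subproof f)).

Lemma sym_invK f : cancel f (sym_inv f).
Proof. by rewrite /sym_inv; case: cid => g []. Qed.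

Lemma symK_inv f : cancel (sym_inv f) f.
Proof. by rewrite /sym_inv; case: cid => g []. Qed.

Lemma sym_mulA : associative sym_mul.
Proof. by move=> f g h; apply: sym_ext. Qed.

Lemma sym_mul1 : left_id sym_one sym_mul.
Proof. by move=> f; apply: sym_ext. Qed.

Lemma sym_1mul : right_id sym_one sym_mul.
Proof. by move=> f; apply: sym_ext. Qed.

Lemma sym_mulV : left_inverse sym_one sym_inv sym_mul.
Proof. by move=> f; apply: sym_ext => x /=; rewrite sym_invK. Qed.

Lemma sym_Vmul : right_inverse sym_one sym_inv sym_mul.
Proof. by move=> f; apply: sym_ext => x /=; rewrite symK_inv. Qed.

HB.instance Definition _ := isGroup.Build (sym T)
  sym_mulA sym_mul1 sym_1mul sym_mulV sym_Vmul.

End SymGroup.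

Definition graph_aut_pred (L : Type) (e : rel L) : pred (sym L) :=
  fun s => `[< {mono s : x y / e x y} >].

Lemma graph_aut_closed (L : Type) (e : rel L) : group_closed (graph_aut_pred e).
Proof.
split=> [|s t /asboolP sP /asboolP tP]; apply/asboolP => x y //=.
by rewrite sP -tP !symK_inv.
Qed.

Definition graph_aut (L : Type) (e : rel L) : Type :=
  {s : sym L | graph_aut_pred e s}.

HB.instance Definition _ (L : Type) (e : rel L) :=
  SubChoice.on (graph_aut e).
HB.instance Definition _ (L : Type) (e : rel L) :=
  SubChoice_isSubGroup.Build (sym L) (graph_aut_pred e) (graph_aut e)
    (graph_aut_closed e).

Definition group_aut_pred (G : groupType) : pred (sym G) :=
  fun s => `[< {morph s : x y / x * y} >].

Lemma group_aut_closed (G : groupType) : group_closed (@group_aut_pred G).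
Proof.
split=> [|s t /asboolP sP /asboolP tP]; apply/asboolP => x y //=.
by rewrite -sP; congr (s _); apply: (bij_inj (symP t)); rewrite tP !symK_inv.
Qed.

Definition group_aut (G : groupType) : Type :=
  {s : sym G | @group_aut_pred G s}.

HB.instance Definition _ (G : groupType) := SubChoice.on (group_aut G).
HB.instance Definition _ (G : groupType) :=
  SubChoice_isSubGroup.Build (sym G) (@group_aut_pred G) (group_aut G)
    (@group_aut_closed G).

(* A cardinal is represented by a type L of that cardinality, so a structure
   with domain the cardinal is a structure whose carrier is L itself: an edge
   relation on L for a graph, a groupType structure c on L for a group. *)
Definition Aut_gf (L : Type) (G : groupType) : Prop :=
  exists e : rel L, simple_graph e /\ isomorphic G (graph_aut e).

Definition Aut_lf (L : Type) (G : groupType) : Prop :=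
  exists c : Group.axioms_ L,
    locally_finite (Group.Pack c) /\ isomorphic G (group_aut (Group.Pack c)).

(* Main.v *)
Require Import Defs.
From mathcomp Require Import all_boot.
From mathcomp Require Import boolp classical_sets functions cardinality.
From mathcomp Require Import wochoice.

(** The trivial group separates the two classes.

    If Aut(G) is trivial, then G is abelian (inner automorphisms are trivial) of
    exponent 2 (inversion is trivial).  Were there [a <> 1] and [b] outside
    [{1, a}], a subgroup M maximal among those containing [a] and not [b] would
    have index 2, and fixing M pointwise while multiplying its complement by [a]
    would be a nontrivial automorphism.  So G has at most two elements.

    On the other hand every infinite set L carries a rigid graph.  Well-order L
    without a maximum, colour it so that consecutive elements get different
    colours, and join [x < y] iff [x] is coloured.  If an automorphism f fixes
    everything below [x], then f preserves the final segment from [x] on, where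
    [x] is either joined to everything or isolated; if [f x] lay strictly above
    [x], it would inherit this property, against the colour of the successor of
    [x] (or of the next element, if the successor is [f x] itself). *)

Local Open Scope classical_set_scope.

(** * Well-orders and alternating colourings *)

(** An infinite well-order has type $\delta + n$ with $\delta$ a nonzero limit and $n$ finite;
    exchanging the summands gives $n + \delta = \delta$, which has no last element. *)
Lemma well_order_no_max (L : Type) : infinite_set [set: L] ->
  exists lt : rel L, [/\ transitive lt,
    forall x y, [\/ lt x y, x = y | lt y x],
    well_founded lt & forall x, exists y, lt x y].
Proof.
elim/Peq: L => L infL; have [R woR] := well_ordering_principle L.
have Rxx : reflexive R by move=> x; apply: (wo_chain_reflexive (withinW woR)).
have Ranti : antisymmetric R.
  by move=> x y; apply: (wo_chain_antisymmetric (withinW woR)).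
have Rtot : total R by move=> x y; apply: (wo_chainW (withinW woR)).
have Rmin (A : set L) x : A x -> exists2 m, A m & forall y, A y -> R m y.
  move=> Ax; have [|m [[/asboolP Am mA] _]] := woR (fun y => `[< A y >]).
    by exists x; apply/asboolP.
  by exists m => // y Ay; apply: mA; apply/asboolP.
have Rtr : transitive R.
  (* Transitivity comes from comparing with the least element of $\{x, y, z\}$. *)
  move=> y x z xy yz.
  have [|m mA mm] := Rmin [set t | t = x \/ t = y \/ t = z] x; first by left.
  have [mx my mz] : [/\ R m x, R m y & R m z].
    by split; apply: mm; [left|right; left|right; right].
  case: mA => [<-//|[e|e]]; subst m.
    by have -> : x = y by apply: Ranti; rewrite xy.
  by have <- : y = z by apply: Ranti; rewrite yz.
pose tail x := `[< finite_set [set y | R x y] >].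
(* All of [tail] lies in the finite final segment of its least element. *)
have finF : finite_set [set x | tail x].
  have [[x tx]|no] := pselect (exists x, tail x); last first.
    by rewrite (_ : [set _ | _] = set0) // -subset0 => x tx; apply: no; exists x.
  have [f /asboolP ff fm] := Rmin [set x | tail x] x tx.
  by apply: sub_finite_set ff => y /fm.
(* Moving the finite final segments to the front removes a possible maximum. *)
pose lt x y := if tail x == tail y then ~~ R y x else tail x.
have lt_tri x y : [\/ lt x y, x = y | lt y x].
  rewrite /lt [tail y == _]eq_sym; case: eqP => [_|].
    have [xy|nxy] := boolP (R x y); last by constructor 3.
    have [yx|nyx] := boolP (R y x); last by constructor 1.
    by constructor 2; apply: Ranti; rewrite xy yx.
  by case: (tail x); [constructor 1|case: (tail y) => //; constructor 3].
exists lt; split; [move=> y x z|exact: lt_tri|move=> x|move=> x].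
- rewrite /lt; case: (tail x); case: (tail y); case: (tail z) => //= nyx nzy;
    by apply: contra nyx => zx; case/orP: (Rtot z y) => [zy|/Rtr->//];
       rewrite zy in nzy.
- apply: contrapT => nx.
  (* The [lt]-least inaccessible element is the [R]-least one inside [tail] if there is any, and
     otherwise the [R]-least of all. *)
  have [m nm mm] : exists2 m, ~ Acc lt m & forall y, ~ Acc lt y -> ~~ lt y m.
    have [[y [ty ny]]|no] := pselect (exists y, tail y /\ ~ Acc lt y).
      have [m [tm nm] mm] := Rmin [set y | tail y /\ ~ Acc lt y] y (conj ty ny).
      exists m => // z nz; rewrite /lt tm eqb_id.
      by case tz: (tail z) => //; rewrite mm.
    have [m nm mm] := Rmin [set y | ~ Acc lt y] x nx.
    exists m => // z nz; have tN w : ~ Acc lt w -> tail w = false.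
      by move=> nw; apply/negP => tw; apply: no; exists w.
    by rewrite /lt !tN // eqxx mm.
  by apply: nm; constructor => y ym; apply: contrapT => /mm; rewrite ym.
- apply: contrapT => no.
  have xmax y : lt y x || (y == x).
    have [->//|->|xy] := lt_tri y x; first by rewrite eqxx orbT.
    by case: no; exists y.
  (* If the maximum [x] is in [tail], so is all of [L]; if not, its final segment for [R] lies in
     [tail] together with [x], hence is finite. *)
  have [tx|tx] := boolP (tail x).
    apply: infL; apply: sub_finite_set finF => y _ /=.
    have := xmax y; rewrite /lt tx eqb_id => /orP[|/eqP->//].
    by case: (tail y).
  have /asboolP[] := tx.
  have := finite_setU [set x] [set y | tail y].
  rewrite propeqE => -[_ /(_ (conj (finite_set1 x) finF))].
  apply: sub_finite_set => y /= xy.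
  have := xmax y; rewrite /lt (negbTE tx) xy /=.
  by case/orP => [|/eqP]; [case: (tail y) => //; right|left].
Qed.

Definition covers {L : Type} (lt : rel L) (x y : L) : Prop :=
  lt x y /\ forall z, lt x z -> ~ lt z y.

(* The parity of n in the decomposition of an element as (limit) + n. *)
Inductive parity {L : Type} (lt : rel L) : bool -> L -> Prop :=
| parity_limit x : (forall p, ~ covers lt p x) -> parity lt false x
| parity_succ b p x : covers lt p x -> parity lt b p -> parity lt (~~ b) x.

(** Colour by parity: it is single-valued because an element covers at most one other, total by
    well-founded induction, and it flips at each cover. The absence of a maximum provides the
    covers. *)
Lemma alternating_coloring {L : Type} (lt : rel L) :
    transitive lt -> (forall x y, [\/ lt x y, x = y | lt y x]) ->
    well_founded lt -> (forall x, exists y, lt x y) ->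
  exists c : pred L, forall x, exists2 y, covers lt x y & c y = ~~ c x.
Proof.
move=> lt_tr lt_tri lt_wf lt_nomax.
have lt_irr x : ~ lt x x.
  by elim/(well_founded_ind lt_wf): x => x IH xx; apply: (IH x).
have covers_inj p q x : covers lt p x -> covers lt q x -> p = q.
  move=> [px pN] [qx qN]; have [pq|//|qp] := lt_tri p q.
    by case: (pN q).
  by case: (qN p).
have parity_fun b b' x : parity lt b x -> parity lt b' x -> b = b'.
  move=> pb; elim: pb b' => {b x} [x lim|b p x px _ IH] b' pb'.
    by case: pb' lim => // b'' p {}x px _ /(_ p).
  case: pb' px => [{}x lim /lim//|b'' q {}x qx pb'' px].
  by rewrite (IH b'') // (covers_inj _ _ _ px qx).
have parity_total x : exists b, parity lt b x.
  elim/(well_founded_ind lt_wf): x => x IH.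
  have [[p px]|lim] := pselect (exists p, covers lt p x); last first.
    by exists false; constructor => p px; apply: lim; exists p.
  by have [b pb] := IH _ px.1; exists (~~ b); apply: parity_succ pb.
exists (fun x => `[< parity lt true x >]) => x.
have [y xy] : exists y, covers lt x y.
  have [y0] := lt_nomax x.
  elim/(well_founded_ind lt_wf): y0 => y IH xy.
  have [[z [xz zy]]|no] := pselect (exists z, lt x z /\ lt z y).
    exact: IH zy xz.
  by exists y; split=> // z xz zy; apply: no; exists z.
exists y => //; have [b pb] := parity_total x.
have pb' := parity_succ lt _ _ _ xy pb.
case: b pb pb' => /= pb pb'.
  by rewrite (asboolT pb); apply/asboolPn => /(parity_fun _ _ _ pb').
rewrite (asboolT pb'); apply/esym/negP => /asboolP.
by move=> /(parity_fun _ _ _ pb).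
Qed.

(** * Rigid graphs *)

Lemma rigid_graph (L : Type) : infinite_set [set: L] ->
  exists e : rel L, simple_graph e /\
    forall f : L -> L, bijective f -> {mono f : x y / e x y} -> f =1 id.
Proof.
move=> /well_order_no_max[lt [lt_tr lt_tri lt_wf lt_nomax]].
have [c cS] := alternating_coloring lt lt_tr lt_tri lt_wf lt_nomax.
have lt_irr x : lt x x = false.
  by apply/negP; elim/(well_founded_ind lt_wf): x => x IH xx; apply: (IH x).
have lt_asym x y : lt x y -> lt y x = false.
  by move=> xy; apply/negP => /(lt_tr _ _ _ xy); rewrite lt_irr.
pose e x y := lt x y && c x || lt y x && c y.
have eE x y : lt x y -> e x y = c x.
  by move=> xy; rewrite /e xy lt_asym //= orbF.
have e_sym : symmetric e by move=> x y; rewrite /e orbC.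
exists e; split; first by split=> // x; rewrite /e lt_irr.
move=> f [g fK gK] fe x; elim/(well_founded_ind lt_wf): x => x IH.
(* If [f x] were below [x], it would be fixed by [f], and injectivity would give [f x = x]. *)
have [fxx|//|xfx] := lt_tri (f x) x.
  by have /(can_inj fK) := IH _ fxx.
(* The preimage [g z] lies above [x], since [f] fixes everything below [x] and [z] is not [f x]. *)
have eful z : lt x z -> z <> f x -> e (f x) z = c x.
  move=> xz zfx; rewrite -{1}(gK z) fe eE //.
  have [//|xgz|gzx] := lt_tri x (g z); first by rewrite xgz gK in zfx.
  by move: xz; rewrite -{1}[z]gK IH // lt_asym.
have [y [xy xyN] cy] := cS x.
have [fxy|yfx|yfx] := lt_tri (f x) y; first by case: (xyN (f x)).
  have [z [yz _] _] := cS y.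
  have zfx : z <> f x by rewrite yfx => zy; rewrite zy lt_irr in yz.
  by have := eful z (lt_tr _ _ _ xy yz) zfx; rewrite yfx eE // cy; case: (c x).
have yNfx : y <> f x by move=> yE; rewrite -yE lt_irr in yfx.
by have := eful y xy yNfx; rewrite e_sym eE // cy; case: (c x).
Qed.

(** * Groups with trivial automorphism group *)

Lemma trivial_Aut_small (G : groupType) :
    (forall f : G -> G, bijective f -> {morph f : x y / (x * y)%g} -> f =1 id) ->
  forall a b : G, a <> 1%g -> b = 1%g \/ b = a.
Proof.
move=> trivA a b a1; apply: contrapT => /not_orP[b1 ba].
have mulC (x y : G) : (x * y = y * x)%g.
  rewrite conjgC; congr (_ * _)%g.
  apply: (trivA (conjg^~ y) (Bijective (conjgK y) (conjgKV y))) => u v.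
  by rewrite conjMg.
have invE (x : G) : (x^-1 = x)%g.
  have bij : bijective (fun y : G => y^-1)%g.
    by exists (fun y => y^-1)%g; apply: invgK.
  by apply: (trivA _ bij) => u v; rewrite invgM mulC.
have mulxx (x : G) : (x * x = 1)%g by rewrite -{1}(invE x) mulVg.
(* Every element is its own inverse, so a submonoid is a subgroup. *)
pose sub (A : set G) := A 1%g /\ forall x y, A x -> A y -> A (x * y)%g.
(* The empty set is allowed because of the empty chain in Zorn's lemma. *)
pose P (A : set G) := (A !=set0 -> sub A /\ A a) /\ ~ A b.
have [F FP Ftot|M [[MS Mb] Mmax]] := @Zorn_bigcup G P.
  split=> [[x [A FA Ax]]|[A FA Ab]]; last by case: (FP A FA) => _ /(_ Ab).
  have [[A1 AM] Aa] := (FP A FA).1 (ex_intro _ x Ax).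
  split; last by exists A.
  split=> [|u v [B FB Bu] [C FC Cv]]; first by exists A.
  have [BC|CB] := Ftot B C FB FC.
    exists C => //; have [[_ CM] _] := (FP C FC).1 (ex_intro _ v Cv).
    by apply: CM => //; apply: BC.
  exists B => //; have [[_ BM] _] := (FP B FB).1 (ex_intro _ u Bu).
  by apply: BM => //; apply: CB.
(* An empty [M] would be properly contained in the admissible set $\{1, a\}$. *)
have {MS} [[M1 MM] Ma] : sub M /\ M a.
  apply: MS; apply: contrapT => M0.
  apply: (Mmax [set x | x = 1%g \/ x = a]).
    split=> [x Mx|/(_ a (or_intror erefl)) Ma]; first by case: M0; exists x.
    by case: M0; exists a.
  split=> [_|[]//]; split; last by right.
  split=> [|x y [->|->] [->|->]]; first (by left); rewrite ?mulg1 ?mul1g ?mulxx;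
    by [left|right].
have MD x y : M x -> M (x * y)%g -> M y.
  by move=> Mx /(MM _ _ Mx); rewrite mulgA mulxx mul1g.
(* The subgroup $M \cup xM$ is strictly larger than $M$ and contains $a$, so by maximality it
   contains $b$; thus $b \in xM$. *)
have Mcoset x : ~ M x -> M (b * x)%g.
  move=> Mx; apply: contrapT => Mbx.
  apply: (Mmax [set y | M y \/ M (x * y)%g]).
    split=> [y My|/(_ x)]; first by left.
    by rewrite /= mulxx => H; apply/Mx/H; right.
  split=> [_|[//|]]; last by rewrite mulC.
  split; last by left.
  split=> [|u v [Mu|Mu] [Mv|Mv]]; first (by left).
  - by left; apply: MM.
  - by right; rewrite mulgA [(x * u)%g]mulC -mulgA; apply: MM.
  - by right; rewrite mulgA; apply: MM.
  - left; have := MM _ _ Mu Mv.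
    by rewrite [(x * u)%g]mulC -mulgA (mulgA x) mulxx mul1g.
(* Both factors lie in the coset $bM$, and $b^2 = 1$. *)
have MNN x y : ~ M x -> ~ M y -> M (x * y)%g.
  move=> /Mcoset Mx /Mcoset My; have := MM _ _ Mx My.
  by rewrite [(b * x)%g]mulC -mulgA (mulgA b) mulxx mul1g.
pose t x := if `[< M x >] then x else (x * a)%g.
have tM x : M x -> t x = x by move=> Mx; rewrite /t asboolT.
have tN x : ~ M x -> t x = (x * a)%g by move=> Mx; rewrite /t asboolF.
have tK : cancel t t.
  move=> x; have [Mx|Mx] := pselect (M x); first by rewrite !tM.
  rewrite (tN x) // tN -?mulgA ?mulxx ?mulg1 // => Mxa.
  by apply/Mx/(MD a); rewrite // mulC.
(* Once [t] is known to be an automorphism, it fixes [b]; hence $ba = b$ and $a = 1$. *)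
apply: a1; apply: (mulgI b); rewrite -tN // mulg1.
apply: trivA; first by exists t.
move=> x y; have [Mx|Mx] := pselect (M x); have [My|My] := pselect (M y).
- by rewrite !tM //; apply: MM.
- by rewrite (tM x) // !tN ?mulgA // => /(MD _ _ Mx).
- by rewrite (tM y) // !tN -?mulgA 1?[(a * y)%g]mulC // mulC => /(MD _ _ My).
- rewrite (tN x) // (tN y) // tM; last exact: MNN.
  by rewrite [(y * a)%g]mulC -mulgA (mulgA a) mulxx mul1g.
Qed.

Theorem theorem1p6 (L : Type) (hL : infinite_set [set: L]) :
  ~ (forall G : groupType, Aut_gf L G <-> Aut_lf L G).
Proof.
move=> eqAut; have [e [eS rigid]] := rigid_graph L hL.
have aut1 (s : graph_aut e) : s = 1%g.
  apply/val_inj/sym_ext => x; rewrite val1.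
  by apply: rigid; [exact: symP|apply/asboolP/(valP s)].
have /eqAut[c [_ [f [g fK gK]]]] : Aut_gf L (graph_aut e).
  by exists e; split=> //; exists idfun; exists id.
pose G := Group.Pack c.
have small : forall a b : G, a <> 1%g -> b = 1%g \/ b = a.
  apply: trivial_Aut_small => h hbij hM x.
  pose s : group_aut G := exist _ (Sym (asboolT hbij)) (asboolT hM).
  (* Triviality of the automorphism group passes from the graph to [G] along the bijection. *)
  have s1 : s = 1%g by rewrite -(gK s) -(gK 1%g) (aut1 (g s)) (aut1 (g 1%g)).
  by have := congr1 (fun s : group_aut G => val (val s) x) s1.
(* [L] carries [G], so it can be neither $\{1\}$ nor $\{1, a\}$. *)
have [a a1] : exists a : G, a <> 1%g.
  apply: contrapT => no; apply: hL; apply: sub_finite_set (finite_set1 (1%g : G)).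
  by move=> x _; apply: contrapT => x1; apply: no; exists x.
apply: hL; apply: sub_finite_set (finite_set2 (1%g : G) a).
by move=> x _; have := small a x a1.
Qed.
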